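(* Let $\beta\in(0,1]$. Let $(A_{m,n})_{m,n\in\mathbb N}$ be an infinite complex matrix such that there exist positive constants $C_0,C_1$ and $\gamma_0\ge0$, $\gamma_1>0$ with $$|A_{m,n}|\le\begin{cases} C_0\, e^{\gamma_0 n^\beta}, & n>m,\\ C_1\, e^{-\gamma_1(m^\beta-n^\beta)}, & n\le m,\end{cases}\qquad m,n\in\mathbb N.$$ Then for every $\varepsilon\in(0,1)$, $\mathcal A$ is a continuous operator from $\mathfrak s^\beta_{\gamma_1+\gamma_0+\varepsilon}$ into $\mathfrak s^\beta_{\gamma_1}$.
   Context: $\mathbb N=\{1,2,\dots\}$. For a matrix $(A_{m,n})_{m,n\in\mathbb N}$, $\mathcal A$ denotes the linear map $(c_n)_{n=1}^\infty\mapsto (a_m)_{m=1}^\infty$ with $a_m=\sum_{n=1}^\infty A_{m,n}c_n$; saying that $\mathcal A$ is a continuous operator from one sequence space into another includes the assertion that these series converge for all sequences in the domain. For $\beta\in(0,1]$ and real $k\ge0$, $\mathfrak s^\beta_k$ is the Banach space of complex sequences $(a_n)_{n=1}^\infty$ with finite norm $\sup_{n\in\mathbb N}|a_n|e^{kn^\beta}$. *)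

(* Defs.v *)
From HB Require Import structures.
From mathcomp Require Import all_boot all_order all_algebra.
From mathcomp Require Import all_classical all_reals all_analysis.
From mathcomp Require Import complex.

Set Implicit Arguments.
Unset Strict Implicit.
Unset Printing Implicit Defensive.

Import Order.TTheory GRing.Theory Num.Theory.
Import numFieldNormedType.Exports.
Import Normc.

Local Open Scope classical_set_scope.
Local Open Scope ring_scope.
Local Open Scope complex_scope.

(* The complex numbers R[i] as a normed space over themselves. *)
HB.instance Definition _ (R : realType) := GRing.ComAlgebra.copy R[i] R[i]^o.
HB.instance Definition _ (R : realType) := NormedModule.copy R[i] R[i]^o.

(* Sequences and matrices indexed by {1, 2, ...} are encoded as functions on
   nat with the index shifted by one: the term at position n : nat is the one
   of index n.+1. Hence n ^ beta is written [idxpow beta n] = (n.+1) `^ beta. *)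
Definition idxpow (R : realType) (beta : R) (n : nat) : R := n.+1%:R `^ beta.

Section WeightedSequences.
Variables (R : realType) (beta k : R).
Implicit Types (a b : nat -> R[i]) (c : R[i]).

Definition weighted a (n : nat) : R := normc (a n) * expR (k * idxpow beta n).

Definition wseq_pred : {pred nat -> R[i]} :=
  [pred a | `[< has_ubound (range (weighted a)) >]].

Record wseq := Wseq {
  wseq_val :> nat -> R[i];
  wseq_valP : wseq_val \in wseq_pred }.

HB.instance Definition _ := [isSub for wseq_val].
HB.instance Definition _ := [Choice of wseq by <:].

Definition wseq_norm a : R := sup (range (weighted a)).

Lemma weighted_ge0 a n : 0 <= weighted a n.
Proof.
rewrite /weighted mulr_ge0 ?expR_ge0//.
by case: (a n) => x y; exact: sqrtr_ge0.
Qed.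

Lemma weightedD a b n : weighted (a + b) n <= weighted a n + weighted b n.
Proof.
by rewrite /weighted -mulrDl ler_wpM2r ?expR_ge0//; exact: le_normcD.
Qed.

Lemma weightedZ c a n : weighted (c *: a) n = normc c * weighted a n.
Proof. by rewrite /weighted mulrA -normcM. Qed.

Lemma wseq_predP a :
  reflect (exists M, forall n, weighted a n <= M) (a \in wseq_pred).
Proof.
apply: (iffP (asboolP _)) => [[M aM]|[M aM]]; exists M.
  by move=> n; apply: aM; exists n.
by move=> _ [n _ <-].
Qed.

Lemma wseq_pred_submod_closed : submod_closed wseq_pred.
Proof.
split=> [|c a b /wseq_predP[M aM] /wseq_predP[N bN]]; apply/wseq_predP.
  by exists 0 => n; rewrite /weighted normc0 mul0r.
exists (normc c * M + N) => n.
rewrite (le_trans (weightedD _ _ _))// lerD// weightedZ ler_wpM2l//.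
by case: c => x y; exact: sqrtr_ge0.
Qed.

HB.instance Definition _ := GRing.isSubmodClosed.Build _ _ wseq_pred
  wseq_pred_submod_closed.

HB.instance Definition _ := [SubChoice_isSubLmodule of wseq by <:].

Lemma weighted_le_norm (a : wseq) n : weighted a n <= wseq_norm a.
Proof.
apply: ub_le_sup; last by exists n.
by have /asboolP := wseq_valP a.
Qed.

Lemma wseq_norm_le a M : (forall n, weighted a n <= M) -> wseq_norm a <= M.
Proof.
move=> aM; apply: ge_sup; first by exists (weighted a 0), 0%N.
by move=> _ [n _ <-].
Qed.

Let normC (a : wseq) : R[i] := (wseq_norm a)%:C.

Let normCD (a b : wseq) : normC (a + b) <= normC a + normC b.
Proof.
rewrite -rmorphD lecR; apply: wseq_norm_le => n.
by rewrite (le_trans (weightedD _ _ _))// lerD// weighted_le_norm.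
Qed.

Let normCZ c (a : wseq) : normC (c *: a) = `|c| * normC a.
Proof.
have norm_ge0 : 0 <= normc c by case: (c) => x y; exact: sqrtr_ge0.
have -> : `|c| = (normc c)%:C by [].
rewrite -rmorphM; congr (_%:C); apply/eqP; rewrite eq_le; apply/andP; split.
  by apply: wseq_norm_le => n; rewrite weightedZ ler_wpM2l// weighted_le_norm.
have [->|c0] := eqVneq c 0.
  by rewrite normc0 mul0r (le_trans _ (weighted_le_norm _ 0))// weighted_ge0.
have nc0 : 0 < normc c.
  by rewrite lt_neqAle norm_ge0 andbT eq_sym; apply: contra c0 => /eqP/eq0_normc ->.
rewrite mulrC -ler_pdivlMr//; apply: wseq_norm_le => n.
by rewrite ler_pdivlMr// mulrC -weightedZ; exact: weighted_le_norm (c *: a) n.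
Qed.

Let normC_eq0 (a : wseq) : normC a = 0 -> a = 0.
Proof.
move=> /(congr1 (@complex.Re R))/= a0; apply/val_inj/funext => n /=.
apply: eq0_normc; have := weighted_le_norm a n.
rewrite a0 /weighted -[leRHS](mul0r (expR (k * idxpow beta n))).
rewrite ler_pM2r ?expR_gt0// => an0; apply/eqP; rewrite eq_le an0/=.
by case: (wseq_val a n) => x y; exact: sqrtr_ge0.
Qed.

(* The norm of a normed space over R[i] takes values in R[i]: here it is the
   real number [wseq_norm a], the supremum of the weighted moduli. *)
HB.instance Definition _ :=
  Lmodule_isNormed.Build R[i] wseq normCD normCZ normC_eq0.

Lemma wseq_normE (a : wseq) : `|a| = (wseq_norm a)%:C.
Proof. by []. Qed.

End WeightedSequences.

Section MatrixMap.
Variable R : realType.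
Implicit Type A : nat -> nat -> R[i].

(* Meaningful only when these series converge. *)
Definition matrix_map A (c : nat -> R[i]) : nat -> R[i] :=
  fun m => limn [series A m n * c n]_n.

Definition continuous_matrix_operator A (beta k l : R) : Prop :=
  (forall (c : wseq beta k) (m : nat), cvgn [series A m n * c n]_n) /\
  exists T : {linear wseq beta k -> wseq beta l},
    continuous T /\
    forall c : wseq beta k, T c = matrix_map A c :> (nat -> R[i]).

End MatrixMap.

(* Main.v *)
(* Split exp(-(gamma1 + gamma0 + eps) n^beta) into its three factors: the first
   one beats the output weight exp(gamma1 m^beta) when m < n and the growth
   exp(gamma1 n^beta) of the entries when n <= m, the second one beats
   exp(gamma0 n^beta). So the weighted matrix is bounded, uniformly in m, by
   (C0 + C1) exp(-eps n^beta), which is summable because exp(x) >= x^j / j!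
   with beta j >= 2. *)
Require Import Defs.
From HB Require Import structures.
From mathcomp Require Import all_boot all_order all_algebra.
From mathcomp Require Import all_classical all_reals all_analysis.
From mathcomp Require Import complex.
From mathcomp Require Import ring lra.
Import Order.TTheory GRing.Theory Num.Theory.
Import numFieldNormedType.Exports.
Import Normc.
Local Open Scope classical_set_scope.
Local Open Scope ring_scope.

Lemma cvg_real_complex {R : realType} {u : nat -> R} {x : R} :
  u @ \oo --> x -> ((u n)%:C)%C @[n --> \oo] --> (x%:C)%C.
Proof.
move=> /cvgrPdist_le ux; apply/cvgrPdist_le => -[e f].
(* Radii live in [R[i]]; positivity there forces the imaginary part to vanish, so only a real [e]
   remains. *)
rewrite ltcE/= => /andP[/eqP -> e0].
have := ux e e0; apply: filterS => n xn.
by rewrite -rmorphB/= normc_def/= expr0n/= addr0 sqrtr_sqr lecR.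
Qed.

Lemma complexE {R : realType} (z : R[i]) :
  z = ((complex.Re z)%:C + 'i *: (complex.Im z)%:C)%C.
Proof. by case: z => a b; rewrite /GRing.scale/=; simpc. Qed.

Lemma cvg_complex {R : realType} {u : nat -> R[i]} {x y : R} :
  complex.Re (u n) @[n --> \oo] --> x -> complex.Im (u n) @[n --> \oo] --> y ->
  u @ \oo --> (x +i* y)%C.
Proof.
move=> /cvg_real_complex ux /cvg_real_complex uy.
rewrite [(x +i* y)%C]complexE/=.
have -> : u = fun n => ((complex.Re (u n))%:C + 'i *: (complex.Im (u n))%:C)%C.
  by apply/funext => n; exact: complexE.
exact: (cvgD ux (cvgZl_tmp uy)).
Qed.

Lemma normr_Re_le {R : realType} (z : R[i]) : `|complex.Re z| <= normc z.
Proof. by rewrite -lecR; exact: normc_ge_Re. Qed.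

Lemma normr_Im_le {R : realType} (z : R[i]) : `|complex.Im z| <= normc z.
Proof.
by case: z => a b /=; rewrite -sqrtr_sqr ler_wsqrtr// lerDr sqr_ge0.
Qed.

Lemma is_cvg_series_dominated {R : realType} {u v : nat -> R} :
  (forall n, `|u n| <= v n) -> cvgn (series v) -> cvgn (series u).
Proof.
move=> uv cv; apply: normed_cvg; apply: (series_le_cvg _ _ uv cv) => n //=.
exact: le_trans (uv n).
Qed.

(** Real and imaginary parts are each dominated by [v], so two real comparison tests suffice. *)
Lemma is_cvg_series_normc_le {R : realType} {u : nat -> R[i]} {v : nat -> R} :
  (forall n, normc (u n) <= v n) -> cvgn (series v) -> cvgn (series u).
Proof.
move=> uv cv.
have cRe : cvgn (series (fun n => complex.Re (u n))).
  by apply: (is_cvg_series_dominated _ cv) => n; exact: le_trans (normr_Re_le _) (uv n).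
have cIm : cvgn (series (fun n => complex.Im (u n))).
  by apply: (is_cvg_series_dominated _ cv) => n; exact: le_trans (normr_Im_le _) (uv n).
apply/cvg_ex; eexists; apply: cvg_complex.
- under eq_fun do rewrite /series/= raddf_sum.
  exact: cRe.
- under eq_fun do rewrite /series/= raddf_sum.
  exact: cIm.
Qed.

Lemma normc_lim_series_le {R : realType} {u : nat -> R[i]} {v : nat -> R} :
  (forall n, normc (u n) <= v n) -> cvgn (series v) ->
  normc (limn (series u)) <= limn (series v).
Proof.
move=> uv cv.
have v0 n : 0 <= v n by rewrite (le_trans _ (uv n))//; case: (u n) => *; exact: sqrtr_ge0.
(* With a slack [e] in [R[i]], the limit can be replaced by one partial sum, to which the finite
   triangle inequality applies. *)
rewrite -lecR -[leLHS]/`|limn (series u)|; apply/ler_addgt0Pr => e e0.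
have /cvgrPdist_le/(_ e e0)[N _ /(_ N (leqnn _))/= uN] :=
  is_cvg_series_normc_le uv cv.
rewrite addrC -[X in `|X|](subrK (series u N)).
rewrite (le_trans (ler_normD _ _))// lerD//.
rewrite (@le_trans _ _ (series v N)%:C%C)//.
  rewrite /series/= rmorph_sum/=.
  apply: le_trans (ler_norm_sum _ _ _) _; apply: ler_sum => i _.
  by rewrite lecR.
rewrite lecR; apply: (nondecreasing_cvgn_le _ cv N).
exact: nondecreasing_series.
Qed.

Lemma is_cvg_series_inv_sqr (R : realType) :
  cvgn (series (fun n => (n.+1%:R ^+ 2)^-1 : R)).
Proof.
apply: nondecreasing_is_cvgn.
  by apply: nondecreasing_series => n _; rewrite invr_ge0 sqr_ge0.
exists 2 => _ [n _ <-].
(* A telescoping majorant makes the induction close: with x = n + 1 its increment 2 / (x (x + 1)) is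
   at least 1 / x^2 because x >= 1. *)
suff : series (fun n => (n.+1%:R ^+ 2)^-1 : R) n <= 2 * (1 - n.+1%:R^-1).
  by move=> /le_trans; apply; rewrite ger_pMr// gerBl invr_ge0.
elim: n => [|n IHn]; first by rewrite /series/= big_geq// invr1 subrr mulr0.
rewrite /series/= big_nat_recr//= (le_trans (lerD IHn (lexx _)))// -subr_ge0.
have -> : n.+2%:R = n.+1%:R + 1 :> R by rewrite -natr1.
have x1 : 1 <= n.+1%:R :> R by rewrite ler1n.
move: (n.+1%:R : R) x1 => x x1.
have -> : 2 * (1 - (x + 1)^-1) - (2 * (1 - x^-1) + (x ^+ 2)^-1) =
  (x - 1) / (x ^+ 2 * (x + 1)) by field; rewrite !gt_eqF//; lra.
by rewrite divr_ge0// ?subr_ge0// mulr_ge0 ?sqr_ge0//; lra.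
Qed.

Lemma is_cvg_series_expR_idxpow {R : realType} {beta eps : R} :
  0 < beta -> 0 < eps -> cvgn (series (fun n => expR (- eps * idxpow beta n))).
Proof.
move=> beta0 eps0.
(* The exponent used is [j.+1], since the exponential bound reads 1 + x^(j+1) / (j+1)! <= exp x.
   Taking x = eps (n+1)^beta, this gives exp x >= K (n+1)^2 by the choice of [j]. *)
pose j := Num.bound (2 / beta).
have j2 : 2 <= beta * j.+1%:R.
  rewrite -ler_pdivrMl// mulrC (@le_trans _ _ j%:R) ?ler_nat//.
  by rewrite ltW// archi_boundP// divr_ge0 ?ltW.
pose K := eps ^+ j.+1 / j.+1`!%:R.
have K0 : 0 < K by rewrite divr_gt0 ?exprn_gt0// ltr0n fact_gt0.
apply: (@series_le_cvg _ _ (fun n => K^-1 * (n.+1%:R ^+ 2)^-1)).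
- by move=> n; exact: expR_ge0.
- by move=> n; rewrite mulr_ge0 ?invr_ge0 ?sqr_ge0 ?ltW.
- move=> n; rewrite mulNr expRN -invfM lef_pV2 ?posrE ?expR_gt0//; last first.
    by rewrite mulr_gt0 ?exprn_gt0.
  have p0 : 0 <= eps * idxpow beta n by rewrite mulr_ge0 ?powR_ge0 ?ltW.
  apply: le_trans (expR_ge1Dxn j p0); rewrite ler_wpDl//.
  rewrite exprMn /K mulrAC ler_pM2r ?invr_gt0 ?ltr0n ?fact_gt0//.
  rewrite ler_pM2l ?exprn_gt0// /idxpow -(powR_mulrn _ (powR_ge0 _ _)).
  by rewrite -powRrM -powR_mulrn// ler_powR// ler1n.
- exact: is_cvg_seriesZ (is_cvg_series_inv_sqr R).
Qed.

(** The majorant [v] of the weighted entries does not depend on the row, so every weighted output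
    coordinate is at most the sum of [v] times the norm of the input. *)
Lemma continuous_matrix_operator_summable {R : realType}
    {A : nat -> nat -> R[i]} {beta k l : R} (v : nat -> R) :
  (forall m n, normc (A m n) * expR (l * idxpow beta m) <=
               v n * expR (k * idxpow beta n)) ->
  cvgn (series v) -> continuous_matrix_operator A beta k l.
Proof.
move=> Av cv.
have nc0 (z : R[i]) : 0 <= normc z by case: z => *; exact: sqrtr_ge0.
have v0 n : 0 <= v n.
  rewrite -(pmulr_lge0 _ (expR_gt0 (k * idxpow beta n))).
  by rewrite (le_trans _ (Av 0%N n))// mulr_ge0 ?expR_ge0.
have term (c : wseq beta k) m n :
    normc (A m n * c n) <=
    wseq_norm beta k c * expR (- (l * idxpow beta m)) * v n.
  rewrite normcM expRN mulrAC ler_pdivlMr ?expR_gt0//.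
  apply: (@le_trans _ _ (v n * weighted beta k c n)).
    by rewrite mulrAC /weighted mulrCA [leRHS]mulrC ler_wpM2r.
  by rewrite mulrC ler_wpM2r// weighted_le_norm.
have cvB (c : wseq beta k) m : cvgn
    (series (fun n => wseq_norm beta k c * expR (- (l * idxpow beta m)) * v n)).
  exact: is_cvg_seriesZ.
have cvA (c : wseq beta k) m : cvgn [series A m n * c n]_n.
  exact: is_cvg_series_normc_le (term c m) (cvB c m).
(* This one estimate serves twice: it puts the image in the target space and it bounds the
   operator. *)
have mapB (c : wseq beta k) m :
    weighted beta l (matrix_map A c) m <= limn (series v) * wseq_norm beta k c.
  rewrite /weighted -ler_pdivlMr ?expR_gt0// -expRN.
  rewrite (le_trans (normc_lim_series_le (term c m) (cvB c m)))//.
  by rewrite (lim_seriesZ _ cv) [leLHS]mulrC mulrA.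
have mapP (c : wseq beta k) : matrix_map A c \in wseq_pred beta l.
  by apply/wseq_predP; exists (limn (series v) * wseq_norm beta k c).
pose f (c : wseq beta k) : wseq beta l := Wseq (mapP c).
have f_linear : linear f.
  move=> a c d; apply/val_inj/funext => m /=.
  rewrite -[RHS]/(a * matrix_map A c m + matrix_map A d m).
  apply: cvg_lim; first exact: norm_hausdorff.
  have -> : [series A m n * (a *: c + d : wseq beta k) n]_n =
            (fun n => a * series (fun n => A m n * c n) n
                      + series (fun n => A m n * d n) n).
    apply/funext => n; rewrite /series/= mulr_sumr -big_split/=.
    by apply: eq_bigr => i _; rewrite mulrDr mulrCA.
  (* Limits of series are additive only under convergence, which [cvA] supplies for both inputs. *)
  apply: cvgD; last exact: cvA.
  exact: (cvgZl_tmp (cvA c m)).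
pose T : {linear wseq beta k -> wseq beta l} :=
  HB.pack f (GRing.isLinear.Build _ _ _ _ f f_linear).
split => //; exists T; split => //.
apply: bounded_linear_continuous; apply/linear_boundedP.
(* Boundedness is required for every constant [r] above some real threshold; the sum of [v] is that
   threshold. *)
exists (limn (series v))%:C%C; split; first by rewrite complex_real.
move=> r vr c; apply: le_trans (ler_wpM2r (normr_ge0 _) (ltW vr)).
by rewrite !wseq_normE -rmorphM/= lecR; apply: wseq_norm_le => m; exact: mapB.
Qed.

Theorem proposition3p6 (R : realType) (beta : R)
  (beta_gt0 : 0 < beta) (beta_le1 : beta <= 1)
  (A : nat -> nat -> R[i]) (C0 C1 gamma0 gamma1 : R)
  (C0_gt0 : 0 < C0) (C1_gt0 : 0 < C1)
  (gamma0_ge0 : 0 <= gamma0) (gamma1_gt0 : 0 < gamma1)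
  (A_bound : forall m n : nat,
    normc (A m n) <=
      if (m < n)%N then C0 * expR (gamma0 * idxpow beta n)
      else C1 * expR (- gamma1 * (idxpow beta m - idxpow beta n)))
  (eps : R) (eps_gt0 : 0 < eps) (eps_lt1 : eps < 1) :
  continuous_matrix_operator A beta (gamma1 + gamma0 + eps) gamma1.
Proof.
apply: (continuous_matrix_operator_summable
  (fun n => (C0 + C1) * expR (- eps * idxpow beta n))); last first.
  exact: is_cvg_seriesZ (is_cvg_series_expR_idxpow beta_gt0 eps_gt0).
move=> m n.
rewrite (le_trans (ler_wpM2r (expR_ge0 _) (A_bound m n)))// -mulrA -expRD.
have pn0 : 0 <= idxpow beta n by exact: powR_ge0.
case: ltnP => mn; rewrite -mulrA -expRD.
(* Above the diagonal the exponents compare because gamma1 m^beta <= gamma1 n^beta. *)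
- have pmn : idxpow beta m <= idxpow beta n.
    by rewrite ge0_ler_powR ?nnegrE ?ltW// ltr_nat ltnS.
  apply: (ler_pM (ltW C0_gt0) (expR_ge0 _)); first by rewrite lerDl ltW.
  by rewrite ler_expR; nra.
(* Here the m^beta terms cancel, leaving gamma1 n^beta <= (gamma1 + gamma0) n^beta. *)
- apply: (ler_pM (ltW C1_gt0) (expR_ge0 _)); first by rewrite lerDr ltW.
  by rewrite ler_expR; nra.
Qed.
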